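(* For a monotone linear operator $A:\mathbb{R}^2\to\mathbb{R}^2$ (with full domain $\mathbb{R}^2$), let its code be the binary string $p\,s\,c\,t$, where $p=1$ if $A$ is paramonotone and $p=0$ otherwise, $s=1$ if $A$ is strictly monotone and $s=0$ otherwise, $c=1$ if $A$ is $3$-cyclic monotone and $c=0$ otherwise, and $t=1$ if $A$ is $3^*$-monotone and $t=0$ otherwise. Then the set of codes that are attained by some monotone linear operator $A:\mathbb{R}^2\to\mathbb{R}^2$ is exactly $$\{0000,\ 1011,\ 1101,\ 1111\}.$$
   Context: $\mathbb{R}^2$ carries its standard inner product $\langle\cdot,\cdot\rangle$. A linear operator $A:\mathbb{R}^2\to\mathbb{R}^2$ is monotone if $\langle x-y,Ax-Ay\rangle\ge 0$ for all $x,y$. For such an $A$ (single-valued, defined everywhere): - paramonotone: $A$ is monotone and $\langle x-y,Ax-Ay\rangle=0$ implies $Ax=Ay$; - strictly monotone: $A$ is monotone and $\langle x-y,Ax-Ay\rangle=0$ implies $x=y$; - $3$-cyclic monotone: $\langle x-y,Ax\rangle+\langle y-z,Ay\rangle+\langle z-x,Az\rangle\ge 0$ for all $x,y,z$; - $3^*$-monotone: $A$ is monotone and for all $z,x$ one has $\sup_{y}\langle z-y,Ay-Ax\rangle<+\infty$. *)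

(* Defs.v *)
From HB Require Import structures.
From mathcomp Require Import all_boot all_order all_algebra.
From mathcomp Require Import boolp classical_sets reals ereal.

Set Implicit Arguments.
Unset Strict Implicit.
Unset Printing Implicit Defensive.

Import Order.TTheory GRing.Theory Num.Theory.
Local Open Scope classical_set_scope.
Local Open Scope ring_scope.

Section MonotoneOperators.
Context {R : realType} {n : nat}.
Implicit Types (u v x y z : 'cV[R]_n) (A : 'cV[R]_n -> 'cV[R]_n).

Definition inner u v : R := \sum_(i < n) u i 0 * v i 0.

Definition monotone_op A : Prop :=
  forall x y, 0 <= inner (x - y) (A x - A y).

Definition paramonotone A : Prop :=
  monotone_op A /\
  forall x y, inner (x - y) (A x - A y) = 0 -> A x = A y.

Definition strictly_monotone A : Prop :=
  monotone_op A /\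
  forall x y, inner (x - y) (A x - A y) = 0 -> x = y.

Definition cyclic3_monotone A : Prop :=
  forall x y z,
    0 <= inner (x - y) (A x) + inner (y - z) (A y) + inner (z - x) (A z).

Definition star3_monotone A : Prop :=
  monotone_op A /\
  forall z x,
    (ereal_sup [set (inner (z - y) (A y - A x))%:E | y in setT] < +oo)%E.

(* The bits are, in order: p, s, c, t. *)
Definition monotonicity_code A : bitseq :=
  [:: `[< paramonotone A >]; `[< strictly_monotone A >];
      `[< cyclic3_monotone A >]; `[< star3_monotone A >] ].

End MonotoneOperators.

(* Main.v *)
Require Import Defs.
From mathcomp Require Import all_boot all_order all_algebra.
From mathcomp Require Import boolp classical_sets reals ereal.
From mathcomp Require Import ring lra.

Import Order.TTheory GRing.Theory Num.Theory.
Local Open Scope classical_set_scope.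
Local Open Scope ring_scope.

(** Write q u for the quadratic form inner u (A u) of a monotone linear
    operator A; it is nonnegative, so its zeros are exactly the kernel of the
    symmetric part of A.

    In every dimension, strict monotonicity implies paramonotonicity and
    3-cyclic monotonicity implies paramonotonicity
    ([cyclic3_monotone_paramonotone]): if q u = 0 but A u <> 0, the 3-cyclic
    inequality along the line spanned by u is affine and nonconstant, hence
    violated far away.  The same argument shows that 3*-monotonicity implies
    paramonotonicity ([star3_monotone_paramonotone]).  Conversely, for a
    paramonotone A with symmetric part S, the inclusion of ker S in ker A lets
    one complete the square in q u - inner w (A u), which gives 3*-monotonicity
    ([paramonotone_star3_monotone]).

    The plane enters only once.  If A is paramonotone but not strictly
    monotone, then some nonzero u satisfies A u = 0 and A^T u = 0, so the
    antisymmetric part of A kills u; in dimension 2 an antisymmetric form with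
    a nonzero radical vanishes, so A is symmetric, hence 3-cyclic monotone
    ([paramonotone_cyclic3_or_strict]).  These implications leave only the four
    listed codes.  They are attained by a quarter turn J, by 0, by 1 + 3 J and
    by 1. *)

(** * The inner product *)

Section Inner.
Context {R : realType} {n : nat}.
Implicit Types (u v x y : 'cV[R]_n) (M : 'M[R]_n).

Lemma innerC x y : inner x y = inner y x.
Proof. by apply: eq_bigr => i _; rewrite mulrC. Qed.

Lemma innerDl x y v : inner (x + y) v = inner x v + inner y v.
Proof. by rewrite -big_split; apply: eq_bigr => i _; rewrite mxE mulrDl. Qed.

Lemma innerZl a x v : inner (a *: x) v = a * inner x v.
Proof. by rewrite mulr_sumr; apply: eq_bigr => i _; rewrite mxE mulrA. Qed.

Lemma innerNl x v : inner (- x) v = - inner x v.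
Proof. by rewrite -scaleN1r innerZl mulN1r. Qed.

Lemma innerDr x y v : inner v (x + y) = inner v x + inner v y.
Proof. by rewrite innerC innerDl !(innerC v). Qed.

Lemma innerZr a x v : inner v (a *: x) = a * inner v x.
Proof. by rewrite innerC innerZl innerC. Qed.

Lemma innerNr x v : inner v (- x) = - inner v x.
Proof. by rewrite innerC innerNl innerC. Qed.

Lemma inner0l v : inner 0 v = 0.
Proof. by rewrite -(scale0r 0) innerZl mul0r. Qed.

Lemma inner0r v : inner v 0 = 0.
Proof. by rewrite innerC inner0l. Qed.

Definition innerE := (innerDl, innerDr, innerNl, innerNr, innerZl, innerZr).

Lemma inner_ge0 x : 0 <= inner x x.
Proof. by apply: sumr_ge0 => i _; rewrite -expr2 sqr_ge0. Qed.

Lemma inner_eq0 x : inner x x = 0 -> x = 0.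
Proof.
move=> /eqP; rewrite psumr_eq0 => [/allP x0|i _]; last by rewrite -expr2 sqr_ge0.
apply/matrixP => i j; rewrite ord1 mxE; apply/eqP.
by have := x0 i (mem_index_enum i); rewrite /= mulf_eq0 orbb.
Qed.

Lemma inner_mulmxr x M y : inner x (M *m y) = inner (M^T *m x) y.
Proof.
have E u v : inner u v = (u^T *m v) 0 0.
  by rewrite mxE; apply: eq_bigr => i _; rewrite mxE.
by rewrite !E trmx_mul trmxK mulmxA.
Qed.

End Inner.

(** * Linear operators in arbitrary dimension *)

Lemma slope0 (R : realFieldType) (a C : R) : (forall t, t * a <= C) -> a = 0.
Proof.
move=> aC; apply/eqP/negP => /negP a0.
by have := aC ((C + 1) / a); rewrite mulfVK // gerDl ler10.
Qed.

(** Row-space inclusion means A *m cokermx B = 0, and each column of cokermx B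
    is a vector killed by B. *)
Lemma submx_ker {F : fieldType} {m1 m2 n : nat}
    {A : 'M[F]_(m1, n)} {B : 'M[F]_(m2, n)} :
  (forall u : 'cV[F]_n, B *m u = 0 -> A *m u = 0) -> (A <= B)%MS.
Proof.
move=> kerBA; rewrite submxE; apply/eqP/matrixP => i j.
have Bj : B *m (cokermx B *m delta_mx j (0 : 'I_1)) = 0.
  by rewrite mulmxA mulmx_coker mul0mx.
have := kerBA _ Bj; rewrite mulmxA -colE => /colP/(_ i).
by rewrite [LHS]mxE [RHS]mxE => ->; rewrite mxE.
Qed.

Section LinearOperators.
Context {R : realType} {n : nat}.
Implicit Types (u v w x y z : 'cV[R]_n) (A : {linear 'cV[R]_n -> 'cV[R]_n}).

Lemma monotone_linP A : monotone_op A <-> forall u, 0 <= inner u (A u).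
Proof.
split=> [mA u|q0 x y]; last by rewrite -linearB.
by have := mA u 0; rewrite -linearB subr0.
Qed.

Lemma paramonotone_linP A : paramonotone A <->
  monotone_op A /\ forall u, inner u (A u) = 0 -> A u = 0.
Proof.
(split=> -[mA pA]; split=> //) => [u|x y].
  by have := pA u 0; rewrite -linearB subr0 linear0.
by rewrite -linearB => /pA /eqP; rewrite linearB subr_eq0 => /eqP.
Qed.

Lemma strictly_monotone_linP A : strictly_monotone A <->
  monotone_op A /\ forall u, inner u (A u) = 0 -> u = 0.
Proof.
(split=> -[mA sA]; split=> //) => [u|x y].
  by have := sA u 0; rewrite -linearB subr0.
by rewrite -linearB => /sA /eqP; rewrite subr_eq0 => /eqP.
Qed.

(** Translating both z and y by x removes the base point x, so only a bound in
    terms of the direction w = z - x is needed. *)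
Lemma star3_monotone_linP A : star3_monotone A <->
  monotone_op A /\ forall w, exists C, forall u, inner (w - u) (A u) <= C.
Proof.
(split=> -[mA bA]; split=> //) => [w|z x].
  have {bA} := bA w 0; set S := [set _ | _ in _] => supS.
  have SP u : S (inner (w - u) (A u))%:E.
    by exists u => //; rewrite linear0 subr0.
  have ubS u := ereal_sup_ubound (SP u).
  case: (ereal_sup S) supS ubS => [C _ ubS|//|_ /(_ 0)]; last by rewrite leeNy_eq.
  by exists C => u; rewrite -lee_fin.
have [C bC] := bA (z - x).
apply: (@le_lt_trans _ _ C%:E); last exact: ltry.
apply: ge_ereal_sup => _ [y _ <-]; rewrite lee_fin.
by have := bC (y - x); rewrite opprB addrA subrK linearB.
Qed.

Lemma strictly_monotone_paramonotone A : strictly_monotone A -> paramonotone A.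
Proof.
move=> /strictly_monotone_linP[mA sA]; apply/paramonotone_linP; split=> // u.
by move=> /sA ->; rewrite linear0.
Qed.

(** At (t u, A u, 0) with q u = 0 the 3-cyclic sum is q (A u) - t |A u|^2. *)
Lemma cyclic3_monotone_paramonotone A : cyclic3_monotone A -> paramonotone A.
Proof.
move=> cA; apply/paramonotone_linP; split=> [x y|u qu0].
  by have := cA x y y; rewrite !innerE; lra.
apply/inner_eq0/(@slope0 _ _ (inner (A u) (A (A u)))) => t.
have := cA (t *: u) (A u) 0; rewrite !linearE !innerE qu0.
by rewrite !inner0l !inner0r; lra.
Qed.

(** For w = A u and q u = 0, the bounded quantity inner (w - t u) (A (t u)) is
    t |A u|^2. *)
Lemma star3_monotone_paramonotone A : star3_monotone A -> paramonotone A.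
Proof.
move=> /star3_monotone_linP[mA bA]; apply/paramonotone_linP; split=> // u qu0.
have [C bC] := bA (A u); apply/inner_eq0/(@slope0 _ _ C) => t.
by have := bC (t *: u); rewrite !linearE !innerE qu0; lra.
Qed.

Lemma linear_mulmx A : exists M, forall u, A u = M *m u.
Proof.
exists (lin1_mx (trmx \o A \o trmx))^T => u.
by rewrite -[RHS]trmxK trmx_mul trmxK mul_rV_lin1 /= !trmxK.
Qed.

(** With M the matrix of A and S = M^T + M, a vector killed by S is a zero of
    q, hence killed by M; so M = D S for some D.  Writing v = D^T w, one gets
    inner w (A u) = inner v (S u), and completing the square gives
    q u - inner w (A u) = q (u - v) - q v >= - q v. *)
Lemma paramonotone_star3_monotone A : paramonotone A -> star3_monotone A.
Proof.
move=> /paramonotone_linP[mA pA]; apply/star3_monotone_linP; split=> // w.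
have q0 := (monotone_linP A).1 mA; have [M AM] := linear_mulmx A.
pose S := M^T + M.
have kerS u : S *m u = 0 -> M *m u = 0.
  move=> Su0; rewrite -AM; apply: pA.
  have := congr1 (inner u) Su0; rewrite mulmxDl innerDr inner0r.
  by rewrite inner_mulmxr trmxK innerC -AM; lra.
have /submxP[D MD] := submx_ker kerS.
pose v := D^T *m w; exists (inner v (A v)) => u.
have wE : inner w (A u) = inner v (A u) + inner u (A v).
  rewrite !AM {1}MD -mulmxA inner_mulmxr -/v mulmxDl innerDr.
  by rewrite inner_mulmxr trmxK innerC [in LHS](innerC v) addrC [in LHS]innerC.
by have := q0 (u - v); rewrite linearB !innerE wE; lra.
Qed.

(** The 3-cyclic sum is then half of q (x - y) + q (y - z) + q (z - x). *)
Lemma symmetric_cyclic3_monotone A :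
  monotone_op A -> (forall x y, inner x (A y) = inner y (A x)) ->
  cyclic3_monotone A.
Proof.
move=> /monotone_linP q0 sym x y z.
have := q0 (x - y); have := q0 (y - z); have := q0 (z - x).
rewrite !linearB !innerE (sym y x) (sym z y) (sym z x); lra.
Qed.

(** Otherwise q (v + t u) = q v + t inner u (A v) would change sign. *)
Lemma monotone_ker_orthogonal A u :
  monotone_op A -> A u = 0 -> forall v, inner u (A v) = 0.
Proof.
move=> /monotone_linP q0 Au0 v; apply: (@slope0 _ _ (inner v (A v))) => t.
have AE : A (v - t *: u) = A v by rewrite linearB linearZ_LR Au0 scaler0 subr0.
by have := q0 (v - t *: u); rewrite AE !innerE; lra.
Qed.

End LinearOperators.

(** * Operators of the plane *)

Section Plane.
Context {R : realType}.
Implicit Types (u v x y : 'cV[R]_2) (A : {linear 'cV[R]_2 -> 'cV[R]_2}).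

Lemma sum_ord2 (F : 'I_2 -> R) : \sum_i F i = F 0 + F 1.
Proof.
by rewrite big_ord_recl big_ord1; congr (_ + F _); apply/val_inj.
Qed.

Lemma mulmx2E (M : 'M[R]_2) v i :
  (M *m v) i 0 = M i 0 * v 0 0 + M i 1 * v 1 0.
Proof. by rewrite mxE sum_ord2. Qed.

Lemma inner2E u v : inner u v = u 0 0 * v 0 0 + u 1 0 * v 1 0.
Proof. exact: sum_ord2. Qed.

Lemma col2_eq0 u : u 0 0 = 0 -> u 1 0 = 0 -> u = 0.
Proof.
by move=> u0 u1; apply: inner_eq0; rewrite inner2E u0 u1 !mul0r addr0.
Qed.

(** A nonzero u with q u = 0 is killed by A and by A^T, hence lies in the
    radical of the alternating form inner x (A y) - inner y (A x), which has to
    vanish in dimension 2; then A is symmetric. *)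
Lemma paramonotone_cyclic3_or_strict A :
  paramonotone A -> strictly_monotone A \/ cyclic3_monotone A.
Proof.
move=> /paramonotone_linP[mA pA].
have [sA|nsA] := pselect (strictly_monotone A); [by left | right].
have [u [u0 Au0]] : exists u, u <> 0 /\ A u = 0.
  apply: contrapT => noker; apply: nsA; apply/strictly_monotone_linP.
  by split=> // u /pA Au0; apply: contrapT => u0; apply: noker; exists u.
have uA := monotone_ker_orthogonal A u mA Au0.
have [M AM] := linear_mulmx A.
have AE v i : A v i 0 = M i 0 * v 0 0 + M i 1 * v 1 0.
  by rewrite AM mulmx2E.
(* The vanishing of A u and A^T u gives (M 0 1 - M 1 0) *: u = 0. *)
have symM : M 0 1 = M 1 0.
  apply/eqP; rewrite -subr_eq0; apply/eqP; apply: contrapT => k0.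
  have [e1 e2] : A u 0 0 = 0 /\ A u 1 0 = 0 by rewrite Au0 !mxE.
  have := uA (delta_mx 0 0); have := uA (delta_mx 1 0).
  rewrite !inner2E !AE !mxE /= => f1 f2; rewrite !AE in e1 e2.
  apply: u0; apply: col2_eq0; apply: (mulfI (introN eqP k0)); lra.
apply: symmetric_cyclic3_monotone => // x y.
by rewrite !inner2E !AE symM; ring.
Qed.

(** The operator a + b J, where J is the rotation by a quarter turn. *)
Definition conformal_mx (a b : R) : 'M[R]_2 :=
  \matrix_(i, j) (if i == j then a else if i == 0 then - b else b).

Definition conformal a b : {linear 'cV[R]_2 -> 'cV[R]_2} :=
  mulmx (conformal_mx a b).

Lemma inner_conformal a b u v : inner u (conformal a b v) =
  a * inner u v + b * (u 1 0 * v 0 0 - u 0 0 * v 1 0).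
Proof.
by rewrite !inner2E !mulmx2E !mxE /=; ring.
Qed.

Lemma conformal_q a b u : inner u (conformal a b u) = a * inner u u.
Proof. by rewrite inner_conformal; ring. Qed.

Lemma conformal_monotone a b : 0 <= a -> monotone_op (conformal a b).
Proof.
by move=> a0; apply/monotone_linP => u; rewrite conformal_q mulr_ge0 ?inner_ge0.
Qed.

Lemma conformal_strictly_monotone a b :
  0 < a -> strictly_monotone (conformal a b).
Proof.
move=> a0; apply/strictly_monotone_linP; split.
  exact/conformal_monotone/ltW.
move=> u; rewrite conformal_q => /eqP; rewrite mulf_eq0 gt_eqF //=.
by move=> /eqP/inner_eq0.
Qed.

Lemma conformal0_not_strictly_monotone b :
  ~ strictly_monotone (conformal 0 b).
Proof.
move=> /strictly_monotone_linP[_ /(_ (delta_mx 0 0))].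
rewrite conformal_q mul0r => /(_ erefl) /colP/(_ 0)/eqP.
by rewrite !mxE oner_eq0.
Qed.

Lemma conformal0_cyclic3_monotone a : 0 <= a -> cyclic3_monotone (conformal a 0).
Proof.
move=> a0; apply: symmetric_cyclic3_monotone; first exact: conformal_monotone.
by move=> x y; rewrite !inner_conformal !mul0r innerC.
Qed.

(** At (e, J e, 0), for the first basis vector e, the 3-cyclic sum is
    2 a - b. *)
Lemma conformal_not_cyclic3_monotone a b :
  2 * a < b -> ~ cyclic3_monotone (conformal a b).
Proof.
move=> ab /(_ (delta_mx 0 0) (delta_mx 1 0) 0).
rewrite !inner_conformal !inner2E !mxE /=; lra.
Qed.

Lemma conformal0_not_paramonotone b : 0 < b -> ~ paramonotone (conformal 0 b).
Proof.
move=> b0 /paramonotone_cyclic3_or_strict[].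
  exact: conformal0_not_strictly_monotone.
by apply: conformal_not_cyclic3_monotone; rewrite mulr0.
Qed.

End Plane.

Theorem mainTheorem1 (R : realType) :
  [set w : bitseq | exists A : {linear 'cV[R]_2 -> 'cV[R]_2},
                      monotone_op A /\ monotonicity_code A = w] =
  [set w : bitseq | w \in [:: [:: false; false; false; false];
                              [:: true; false; true; true];
                              [:: true; true; false; true];
                              [:: true; true; true; true] ] ].
Proof.
apply/seteqP; split=> [w [A [_ <-]]|w /=].
  rewrite /= /monotonicity_code.
  have sp := strictly_monotone_paramonotone A.
  have cp := cyclic3_monotone_paramonotone A.
  have tp := star3_monotone_paramonotone A.
  have pt := paramonotone_star3_monotone A.
  have psc := paramonotone_cyclic3_or_strict A.
  by do 4![case: asboolP => ?] => //; exfalso; tauto.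
rewrite !inE => /or4P[] /eqP ->.
- exists (conformal 0 1); split; first exact: conformal_monotone.
  have np := conformal0_not_paramonotone 1 (@ltr01 R).
  congr [:: _; _; _; _]; apply/asboolPn; move: np; apply: contra_not => //.
  + exact: strictly_monotone_paramonotone.
  + exact: cyclic3_monotone_paramonotone.
  + exact: star3_monotone_paramonotone.
- exists (conformal 0 0); split; first exact: conformal_monotone.
  have c := conformal0_cyclic3_monotone 0 (@lexx _ R 0).
  have p := cyclic3_monotone_paramonotone _ c.
  congr [:: _; _; _; _]; [exact/asboolP | | exact/asboolP | ].
    exact/asboolPn/conformal0_not_strictly_monotone.
  exact/asboolP/paramonotone_star3_monotone.
- have s : strictly_monotone (conformal 1 3 : _ -> 'cV[R]_2).
    exact: conformal_strictly_monotone.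
  have p := strictly_monotone_paramonotone _ s.
  exists (conformal 1 3); split; first exact: s.1.
  congr [:: _; _; _; _]; [exact/asboolP | exact/asboolP | | ].
    by apply/asboolPn/conformal_not_cyclic3_monotone; lra.
  exact/asboolP/paramonotone_star3_monotone.
- have s : strictly_monotone (conformal 1 0 : _ -> 'cV[R]_2).
    exact: conformal_strictly_monotone.
  have p := strictly_monotone_paramonotone _ s.
  exists (conformal 1 0); split; first exact: s.1.
  congr [:: _; _; _; _]; [exact/asboolP | exact/asboolP | | ].
    exact/asboolP/conformal0_cyclic3_monotone.
  exact/asboolP/paramonotone_star3_monotone.
Qed.
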